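(* Let $d\ge2$, let $\rho$ be a strictly positive density matrix on $\mathbb{C}^d$, and let $\lambda_1\le\lambda_2$ be its smallest and second-smallest eigenvalues (counted with multiplicity). Then for all Hermitian $d\times d$ complex matrices $A,B$, $$V_\rho(A)\,V_\rho(B)\;\ge\;\frac{\lambda_1\lambda_2}{\lambda_1+\lambda_2}\,\bigl\langle|[A,B]|^2\bigr\rangle_\rho .$$ Moreover, $\frac{\lambda_1\lambda_2}{\lambda_1+\lambda_2}$ is the largest constant $b$ (depending only on $\rho$) for which $V_\rho(A)V_\rho(B)\ge b\,\langle|[A,B]|^2\rangle_\rho$ holds for all Hermitian $d\times d$ matrices $A,B$.
   Context: A strictly positive density matrix is a positive definite $d\times d$ complex matrix of trace $1$. $\langle X\rangle_\rho:=\mathrm{Tr}(X\rho)$; for Hermitian $X$, $V_\rho(X):=\mathrm{Tr}\bigl((X-\langle X\rangle_\rho\mathbb{I})^2\rho\bigr)$. $[A,B]:=AB-BA$ and $|[A,B]|^2:=[A,B]^\dagger[A,B]$. *)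

(* Defs.v *)
From mathcomp Require Import all_boot all_order all_algebra.
From mathcomp Require Import sesquilinear spectral.
From mathcomp Require Import reals.
From mathcomp Require Import complex.

Set Implicit Arguments.
Unset Strict Implicit.
Unset Printing Implicit Defensive.

Import Order.TTheory GRing.Theory Num.Theory.

Local Open Scope ring_scope.
Local Open Scope complex_scope.
Local Open Scope sesquilinear_scope.

(* Traces of Hermitian observables are kept in R[i]. On R[i], x <= y means that
   y - x is real and nonnegative. *)
Section Uncertainty.
Context {R : realType} {d : nat}.
Local Notation C := R[i].
Implicit Types rho A B X : 'M[C]_d.

Definition posdefmx X : Prop :=
  X \is hermsymmx /\
  (forall v : 'cV[C]_d, v != 0 -> 0 < (v ^t* *m X *m v) 0 0).

Definition strictly_positive_density rho : Prop :=
  posdefmx rho /\ \tr rho = 1.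

Definition expectation rho X : C := \tr (X *m rho).

Definition variance rho X : C :=
  let Y := X - (expectation rho X)%:M in expectation rho (Y *m Y).

Definition commutator A B : 'M[C]_d := A *m B - B *m A.

Definition abs2mx X : 'M[C]_d := X ^t* *m X.

(* The roots of the characteristic polynomial, repeated according to
   multiplicity, in nondecreasing order. Taking real parts loses nothing for
   Hermitian X, the only case of interest: its eigenvalues are real. *)
Definition eigenvalues X : seq R :=
  sort <=%R
    [seq complex.Re z | z <- sval (closed_field_poly_normal (char_poly X))].

Definition uncertainty_bound rho (b : R) : Prop :=
  forall A B, A \is hermsymmx -> B \is hermsymmx ->
    variance rho A * variance rho B
      >= b%:C * expectation rho (abs2mx (commutator A B)).

End Uncertainty.

(* Main.v *)
Require Import Defs.
From mathcomp Require Import all_boot all_order all_algebra.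
From mathcomp Require Import sesquilinear spectral ring.
From mathcomp Require Import reals.
From mathcomp Require Import complex.

(* Diagonalize rho and put sigma = rho^(1/2), K = rho^(-1/2). For centered A and
   B, with X = A sigma and Y = B sigma, the claim becomes the generalization
     |X K Y - Y K X|^2 <= (k1^2 + k2^2) |X|^2 |Y|^2
   of the Bottcher-Wenzel inequality in the Hilbert-Schmidt norm, k1 and k2 being
   the two largest singular values of K, here lambda1^(-1/2), lambda2^(-1/2).
   Let U = X K, V = K X, |Y| = 1, and write Z' for the adjoint of Z. As in
   Audenaert's proof of the case K = 1,
     |U Y - Y V|^2 + |U' Y + Y V'|^2
       = |U Y|^2 + |U' Y|^2 + |Y V|^2 + |Y V'|^2,
   and Cauchy-Schwarz against Y bounds the second term from below by
   |tr(U Y Y') + tr(V Y' Y)|^2. The resulting bound depends on Y only through the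
   states Y Y' and Y' Y. The other terms are linear in these states, and the
   extreme points of the set of states with prescribed tr(U .), resp. tr(V .),
   have rank one, so the states may be replaced by projections on unit vectors f
   and g. What remains is a bound on the norm of a real linear map in X; passing
   to the adjoint map and completing squares reduces it to the norm of an
   antisymmetric matrix. The largest singular value of such a matrix has
   multiplicity at least two, so its norm is attained on any hyperplane, where
   the bound is elementary.
   Optimality: in an eigenbasis of rho take A = e1 e2' + e2 e1' and
   B = lambda2 e1 e1' - lambda1 e2 e2'. *)

Set Implicit Arguments.
Unset Strict Implicit.
Unset Printing Implicit Defensive.

Import Order.TTheory GRing.Theory Num.Theory.

Local Open Scope complex_scope.
Local Open Scope ring_scope.
Local Open Scope sesquilinear_scope.

(** * The Hilbert-Schmidt inner product *)

Section HilbertSchmidt.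
Context {C : numClosedFieldType}.

Definition ip m n (X Y : 'M[C]_(m, n)) : C := \tr (X^t* *m Y).
Definition nsq m n (X : 'M[C]_(m, n)) : C := ip X X.

Lemma adjmxM m n p (X : 'M[C]_(m, n)) (Y : 'M[C]_(n, p)) :
  (X *m Y)^t* = Y^t* *m X^t*.
Proof. by rewrite trmx_mul map_mxM. Qed.

Lemma adjmxD m n (X Y : 'M[C]_(m, n)) : (X + Y)^t* = X^t* + Y^t*.
Proof. by rewrite linearD map_mxD. Qed.

Lemma adjmxN m n (X : 'M[C]_(m, n)) : (- X)^t* = - X^t*.
Proof. by rewrite linearN map_mxN. Qed.

Lemma adjmxZ m n (a : C) (X : 'M[C]_(m, n)) : (a *: X)^t* = a^* *: X^t*.
Proof. by rewrite linearZ map_mxZ. Qed.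

Lemma ipE m n (X Y : 'M[C]_(m, n)) : ip X Y = \sum_i \sum_j (X j i)^* * Y j i.
Proof.
rewrite /ip /mxtrace; apply: eq_bigr => i _; rewrite mxE.
by apply: eq_bigr => j _; rewrite !mxE.
Qed.

Lemma ip_conj m n (X Y : 'M[C]_(m, n)) : (ip X Y)^* = ip Y X.
Proof.
rewrite !ipE rmorph_sum; apply: eq_bigr => i _; rewrite rmorph_sum.
by apply: eq_bigr => j _; rewrite rmorphM /= conjCK mulrC.
Qed.

Lemma ipDr m n (X Y Z : 'M[C]_(m, n)) : ip X (Y + Z) = ip X Y + ip X Z.
Proof. by rewrite /ip mulmxDr linearD. Qed.
Lemma ipNr m n (X Y : 'M[C]_(m, n)) : ip X (- Y) = - ip X Y.
Proof. by rewrite /ip mulmxN linearN. Qed.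
Lemma ipBr m n (X Y Z : 'M[C]_(m, n)) : ip X (Y - Z) = ip X Y - ip X Z.
Proof. by rewrite ipDr ipNr. Qed.
Lemma ipZr m n a (X Y : 'M[C]_(m, n)) : ip X (a *: Y) = a * ip X Y.
Proof. by rewrite /ip -scalemxAr linearZ. Qed.
Lemma ipDl m n (X Y Z : 'M[C]_(m, n)) : ip (X + Y) Z = ip X Z + ip Y Z.
Proof. by rewrite /ip adjmxD mulmxDl linearD. Qed.
Lemma ipNl m n (X Y : 'M[C]_(m, n)) : ip (- X) Y = - ip X Y.
Proof. by rewrite /ip adjmxN mulNmx linearN. Qed.
Lemma ipBl m n (X Y Z : 'M[C]_(m, n)) : ip (X - Y) Z = ip X Z - ip Y Z.
Proof. by rewrite ipDl ipNl. Qed.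
Lemma ipZl m n a (X Y : 'M[C]_(m, n)) : ip (a *: X) Y = a^* * ip X Y.
Proof. by rewrite /ip adjmxZ -scalemxAl linearZ. Qed.

Lemma ip_mulmxl m n p (A : 'M[C]_(p, m)) (X : 'M[C]_(m, n)) Y :
  ip (A *m X) Y = ip X (A^t* *m Y).
Proof. by rewrite /ip adjmxM -mulmxA. Qed.

Lemma ip_mulmxr m n p (A : 'M[C]_(n, p)) (X : 'M[C]_(m, n)) Y :
  ip (X *m A) Y = ip X (Y *m A^t*).
Proof. by rewrite /ip adjmxM -mulmxA mxtrace_mulC mulmxA. Qed.

Lemma ip_adj m n (X Y : 'M[C]_(m, n)) : ip (X^t*) (Y^t*) = ip Y X.
Proof. by rewrite /ip trmxCK mxtrace_mulC. Qed.

Lemma nsq_adj m n (X : 'M[C]_(m, n)) : nsq (X^t*) = nsq X.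
Proof. exact: ip_adj. Qed.

Lemma ip_rank1 m n (u w : 'cV[C]_m) (v z : 'cV[C]_n) :
  ip (u *m v^t*) (w *m z^t*) = ip u w * ip z v.
Proof.
rewrite ip_mulmxl mulmxA /ip (mx11_scalar (u^t* *m w)) mul_scalar_mx.
rewrite -scalemxAr linearZ /= trmxCK mxtrace_mulC; congr (_ * _).
by rewrite mxtrace_scalar mulr1n.
Qed.

Lemma ip_rank1l m n (u : 'cV[C]_m) (v : 'cV[C]_n) X :
  ip (u *m v^t*) X = ip u (X *m v).
Proof. by rewrite ip_mulmxr trmxCK. Qed.

Lemma nsq_sum m n (X : 'M[C]_(m, n)) : nsq X = \sum_i \sum_j `|X j i| ^+ 2.
Proof.
rewrite /nsq ipE; apply: eq_bigr => i _; apply: eq_bigr => j _.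
by rewrite mulrC normCK.
Qed.

Lemma nsq_ge0 m n (X : 'M[C]_(m, n)) : 0 <= nsq X.
Proof.
rewrite nsq_sum; apply: sumr_ge0 => i _; apply: sumr_ge0 => j _.
exact: exprn_ge0.
Qed.

Lemma nsq_eq0 m n (X : 'M[C]_(m, n)) : nsq X = 0 -> X = 0.
Proof.
rewrite nsq_sum => /eqP; rewrite psumr_eq0; last first.
  by move=> i _; apply: sumr_ge0 => j _; apply: exprn_ge0.
move=> /allP H; apply/matrixP => j i; rewrite mxE.
have /= := H i (mem_index_enum _); rewrite psumr_eq0; last first.
  by move=> k _; apply: exprn_ge0.
by move=> /allP/(_ j (mem_index_enum _)) /=; rewrite expf_eq0 /= normr_eq0 => /eqP.
Qed.

Lemma nsq_gt0 m n (X : 'M[C]_(m, n)) : X != 0 -> 0 < nsq X.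
Proof.
by move=> X0; rewrite lt_def nsq_ge0 andbT; apply: contra X0 => /eqP/nsq_eq0 ->.
Qed.

Lemma nsqZ m n a (X : 'M[C]_(m, n)) : nsq (a *: X) = a * a^* * nsq X.
Proof. by rewrite /nsq ipZl ipZr mulrA (mulrC a). Qed.

Lemma nsqN m n (X : 'M[C]_(m, n)) : nsq (- X) = nsq X.
Proof. by rewrite /nsq ipNl ipNr opprK. Qed.

Lemma ip_CauchySchwarz m n (X Y : 'M[C]_(m, n)) :
  ip X Y * (ip X Y)^* <= nsq X * nsq Y.
Proof.
have [->|X0] := eqVneq X 0.
  have z0 Z : ip 0 Z = 0 :> C by rewrite -(scale0r Z) ipZl conjC0 mul0r.
  by rewrite /nsq !z0 !mul0r.
have n0 := nsq_gt0 X0.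
have := nsq_ge0 (nsq X *: Y - ip X Y *: X).
have -> : nsq (nsq X *: Y - ip X Y *: X) =
   nsq X * (nsq X * nsq Y - ip X Y * (ip X Y)^*).
  have nr : (nsq X)^* = nsq X by rewrite ip_conj.
  rewrite {1}/nsq ipBl !ipBr !ipZl !ipZr nr -/(nsq X) -/(nsq Y).
  rewrite -(ip_conj X Y); ring.
by rewrite pmulr_rge0 // subr_ge0.
Qed.

Lemma nsq_unitary m n p (P : 'M[C]_(m, n)) (X : 'M[C]_(n, p)) :
  P^t* *m P = 1%:M -> nsq (P *m X) = nsq X.
Proof. by move=> PP; rewrite /nsq ip_mulmxl mulmxA PP mul1mx. Qed.

(** * Spectral decomposition and the norm of antisymmetric matrices *)

Lemma unitarymx_left n (P : 'M[C]_n) : P \is unitarymx -> P^t* *m P = 1%:M.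
Proof. by move=> PU; rewrite -(invmx_unitary PU) mulVmx ?unitarymx_unit. Qed.

Lemma hermitian_spectral n (G : 'M[C]_n) : G^t* = G ->
  exists P (d : 'rV[C]_n), [/\ P *m P^t* = 1%:M, P^t* *m P = 1%:M,
    G = P^t* *m diag_mx d *m P & forall i, d 0 i \is Num.real].
Proof.
move=> GH.
have Gh : G \is hermsymmx.
  by apply/is_hermitianmxP; rewrite expr0 scale1r GH.
have := orthomx_spectralP (hermitian_normalmx Gh).
rewrite invmx_unitary ?spectral_unitarymx // => E.
exists (spectralmx G), (spectral_diag G); split => //.
- exact/unitarymxP/spectral_unitarymx.
- exact/unitarymx_left/spectral_unitarymx.
- move=> i; have /mxOverP := hermitian_spectral_diag_real Gh; exact.
Qed.

Lemma hermitian_form_le n (G : 'M[C]_n) (t : C) : G^t* = G ->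
  (forall mu (v : 'cV[C]_n), v != 0 -> G *m v = mu *: v -> mu <= t) ->
  forall v : 'cV[C]_n, ip v (G *m v) <= t * nsq v.
Proof.
move=> /hermitian_spectral[P [d [PP PP' -> dR]]] H v.
have dt i : d 0 i <= t.
  (* [P^t* *m delta_mx i 0] is a unit eigenvector with eigenvalue [d 0 i]. *)
  apply: (H _ (P^t* *m delta_mx i 0)).
    apply: contra_neq (oner_neq0 C) => E.
    have : nsq (P *m (P^t* *m delta_mx i (0 : 'I_1))) = 0.
      rewrite E mulmx0 /nsq ipE big1 // => k _; rewrite big1 // => l _.
      by rewrite !mxE mulr0.
    rewrite mulmxA PP mul1mx nsq_sum big_ord1 (bigD1 i) //= big1 => [|j ji].
      by rewrite addr0 !mxE !eqxx normr1 expr1n => ->.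
    by rewrite !mxE (negPf ji) normr0 expr0n.
  rewrite -!mulmxA (mulmxA P) PP mul1mx scalemxAr; congr (_ *m _).
  apply/matrixP => k l; rewrite mul_diag_mx !mxE.
  by have [->|] := eqVneq k i; rewrite ?mulr0.
rewrite -(nsq_unitary v PP') -!mulmxA -[X in ip X]mul1mx -PP' -mulmxA.
rewrite ip_mulmxl trmxCK !mulmxA PP mul1mx -mulmxA.
move: (P *m v) => w; rewrite mul_diag_mx /ip nsq_sum mulr_sumr.
rewrite ler_sum // => i _; rewrite mxE mulr_sumr ler_sum // => j _.
rewrite !mxE mulrCA -normCKC; apply: ler_wpM2r; first exact: exprn_ge0.
exact: dt.
Qed.

(* For antisymmetric [A], an eigenvector [v] of [A^t* *m A] and [conj (A v)] are
   orthogonal eigenvectors of the same eigenvalue, so some nonzero vector of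
   this eigenspace lies in any given hyperplane. *)
Lemma antisymmetric_norm_le n (A : 'M[C]_n) (h : 'rV[C]_n) (t : C) :
  A^T = - A -> 0 <= t ->
  (forall v : 'cV[C]_n, h *m v = 0 -> nsq (A *m v) <= t * nsq v) ->
  forall v : 'cV[C]_n, nsq (A *m v) <= t * nsq v.
Proof.
move=> AT t0 H v; rewrite /nsq ip_mulmxl mulmxA; apply: hermitian_form_le.
  by rewrite adjmxM trmxCK.
move=> mu {}v v0 Ev.
have key (z : 'cV[C]_n) :
    z != 0 -> h *m z = 0 -> A^t* *m A *m z = mu *: z -> mu <= t.
  move=> z0 hz Ez; have := H z hz; rewrite /nsq ip_mulmxl mulmxA Ez ipZr.
  by rewrite ler_pM2r // nsq_gt0.
pose w := map_mx Num.conj (A *m v).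
have AA : A^t* = - map_mx Num.conj A by rewrite AT map_mxN.
have Ew : A^t* *m A *m w = mu *: w.
  have mr : mu^* = mu.
    have E : mu * nsq v = nsq (A *m v) by rewrite {2}/nsq ip_mulmxl mulmxA Ev ipZr.
    have := congr1 Num.conj E; rewrite rmorphM /= !ip_conj -/(nsq _) -/(nsq _) -E.
    by move=> /mulIf; apply; apply: lt0r_neq0; apply: nsq_gt0.
  have : map_mx Num.conj (A *m (A^t* *m A *m v))
      = map_mx Num.conj (A *m (mu *: v)) by rewrite Ev.
  rewrite -scalemxAr map_mxZ /= mr -/w => <-.
  rewrite AA !(map_mxM, map_mxN) -map_mx_comp (map_mx_id conjCK) /w map_mxM.
  by rewrite !(mulmxN, mulNmx) !mulmxA.
(* [ip w v] is the bilinear form of [A] evaluated at [v] twice, which antisymmetry makes equal to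
   its own negative. *)
have vw : ip w v = 0.
  have Ew' : ip w v = \tr (v^T *m (A *m v)).
    rewrite /ip -map_trmx -map_mx_comp (map_mx_id conjCK) -mxtrace_tr.
    by rewrite trmx_mul trmxK.
  have E0 : ip w v = - ip w v.
    rewrite {1}Ew' -mxtrace_tr !trmx_mul trmxK AT mulmxN mulNmx linearN /=.
    by rewrite -mulmxA Ew'.
  by apply/eqP; rewrite -[_ == 0](mulrn_eq0 _ 2) mulr2n {1}E0 addNr.
have [hv|hv] := eqVneq (h *m v) 0; first exact: (key v).
pose z := (h *m w) 0 0 *: v - (h *m v) 0 0 *: w.
have hz : h *m z = 0.
  rewrite mulmxBr -!scalemxAr; move: (h *m w) (h *m v) => a b.
  by apply/matrixP => i j; rewrite !ord1 !mxE mulrC subrr.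
have hv0 : (h *m v) 0 0 != 0.
  by apply: contra hv => /eqP E; rewrite (mx11_scalar (h *m v)) E -scalemx1 scale0r.
have [w0|w0] := eqVneq w 0.
  have : A *m v = 0.
    apply/matrixP => i j; move/matrixP: w0 => /(_ i j); rewrite !mxE => /eqP.
    by rewrite conjC_eq0 => /eqP.
  move=> E; move: Ev; rewrite -mulmxA E mulmx0 => /esym/eqP.
  by rewrite scaler_eq0 (negPf v0) orbF => /eqP ->.
apply: (key z) => //; last first.
  by rewrite mulmxBr -!scalemxAr Ew Ev !scalerA ![_ * mu]mulrC -!scalerA scalerBr.
apply: contra_neq w0 => z0; apply: nsq_eq0.
have : ip w z = 0 by rewrite z0 -(scale0r 0) ipZr mul0r.
rewrite /z ipBr !ipZr vw mulr0 sub0r => /eqP; rewrite oppr_eq0 mulf_eq0 (negPf hv0) /=.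
by move=> /eqP.
Qed.

Lemma nsq_col_mx m n p (X : 'M[C]_(m, p)) (Y : 'M[C]_(n, p)) :
  nsq (col_mx X Y) = nsq X + nsq Y.
Proof. by rewrite /nsq /ip tr_col_mx map_row_mx mul_row_col linearD. Qed.

Lemma nsq_conjmx m n (X : 'M[C]_(m, n)) : nsq (map_mx Num.conj X) = nsq X.
Proof.
rewrite !nsq_sum; apply: eq_bigr => i _; apply: eq_bigr => j _.
by rewrite mxE norm_conjC.
Qed.

Lemma nsq_scalar1 (a : C) : nsq (a%:M : 'M_1) = a * a^*.
Proof. by rewrite nsq_sum !big_ord1 mxE mulr1n normCK. Qed.

Lemma ip_scalar1 n (u v : 'cV[C]_n) : u^t* *m v = (ip u v)%:M.
Proof. by rewrite /ip [X in \tr X]mx11_scalar mxtrace_scalar mulr1n -mx11_scalar. Qed.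

Lemma nsqD m n (X Y : 'M[C]_(m, n)) :
  nsq (X + Y) = nsq X + nsq Y + (ip X Y + ip Y X).
Proof. by rewrite /nsq !(ipDl, ipDr); ring. Qed.

Lemma nsqB m n (X Y : 'M[C]_(m, n)) :
  nsq (X - Y) = nsq X + nsq Y - (ip X Y + ip Y X).
Proof. by rewrite /nsq !(ipBl, ipBr); ring. Qed.

Lemma nsq_rank1 m n (u : 'cV[C]_m) (v : 'cV[C]_n) :
  nsq (u *m v^t*) = nsq u * nsq v.
Proof. exact: ip_rank1. Qed.

Lemma nsq_proj_compl n (g v : 'cV[C]_n) : nsq g = 1 ->
  nsq (v - ip g v *: g) = nsq v - ip g v * ip v g.
Proof.
move=> g1; rewrite nsqB nsqZ ip_conj g1 ipZl ipZr ip_conj; ring.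
Qed.

Lemma Bessel1 n (g v : 'cV[C]_n) : nsq g = 1 -> ip g v * ip v g <= nsq v.
Proof. by move=> g1; rewrite -subr_ge0 -nsq_proj_compl // nsq_ge0. Qed.

(** The left side is the squared norm of the image, under an antisymmetric block matrix, of a vector
    built from [c], [p] and [o]. By [antisymmetric_norm_le] only the hyperplane [c = 0] matters.
    There the gap between the two sides is the sum of the gaps in the two hypotheses and of |q p' -
    o s'|^2. *)
Lemma skew_block_norm_le m n (s : 'cV[C]_m) (q : 'cV[C]_n) (N : 'M[C]_(n, m))
    (t : C) :
  0 <= t ->
  (forall p, ip s p * ip p s + nsq (N *m p) <= (t - nsq q) * nsq p) ->
  (forall o, ip q o * ip o q + nsq (N^t* *m o) <= (t - nsq s) * nsq o) ->
  forall c p o,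
    (ip s p + ip o q) * (ip p s + ip q o) + nsq (N *m p + c^* *: q)
      + nsq (N^t* *m o - c *: s) <= t * (c * c^* + nsq p + nsq o).
Proof.
move=> t0 H1 H2.
pose A : 'M[C]_(1 + (m + n)) :=
  block_mx 0 (row_mx s^T (q^t*))
    (col_mx (- s) (- map_mx Num.conj q))
    (block_mx 0 (N^t*) (- map_mx Num.conj N) 0).
(* [A] has to be applied to [conj p], because [p] occurs linearly where [c] and
   [o] occur antilinearly. *)
pose v c p o : 'cV[C]_(1 + (m + n)) :=
  col_mx c%:M (col_mx (map_mx Num.conj p) o).
have vE x : exists c p o, x = v c p o.
  exists (usubmx x 0 0), (map_mx Num.conj (usubmx (dsubmx x))), (dsubmx (dsubmx x)).
  by rewrite /v -map_mx_comp (map_mx_id conjCK) -mx11_scalar !vsubmxK.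
have nv c p o : nsq (v c p o) = c * c^* + nsq p + nsq o.
  by rewrite /v !nsq_col_mx nsq_scalar1 nsq_conjmx addrA.
have nAv c p o : nsq (A *m v c p o) =
    (ip s p + ip o q) * (ip p s + ip q o) + nsq (N *m p + c^* *: q)
      + nsq (N^t* *m o - c *: s).
  have -> : A *m v c p o = col_mx (ip p s + ip q o)%:M
      (col_mx (N^t* *m o - c *: s) (- map_mx Num.conj (N *m p + c^* *: q))).
    rewrite /A /v !mul_block_col mul_col_mx mul_row_col !mul0mx add0r addr0 add0r.
    rewrite ip_scalar1 raddfD /= !mul_mx_scalar add_col_mx; congr (col_mx _ _).
      congr (_ + _); rewrite -?ip_scalar1 //.
      have T1 (x : 'M[C]_1) : x^T = x by rewrite [x]mx11_scalar tr_scalar_mx.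
      by rewrite -[RHS]T1 trmx_mul -map_trmx trmxK.
    congr col_mx; first by rewrite addrC scalerN.
    rewrite map_mxD map_mxM map_mxZ /= conjCK opprD mulNmx scalerN addrC.
    by [].
  rewrite !nsq_col_mx nsqN nsq_conjmx nsq_scalar1 rmorphD /= !ip_conj; ring.
have AT : A^T = - A.
  rewrite /A tr_block_mx tr_row_mx tr_col_mx tr_block_mx opp_block_mx.
  rewrite opp_row_mx opp_col_mx opp_block_mx !trmx0 !oppr0 !opprK trmxK.
  rewrite !linearN /= !map_trmx !trmxK.
  by [].
have H (x : 'cV_(1 + (m + n))) :
    row_mx 1%:M 0 *m x = 0 -> nsq (A *m x) <= t * nsq x.
  have [c [p [o ->]]] := vE x.
  rewrite /v mul_row_col mul1mx mul0mx addr0 => /matrixP/(_ 0 0).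
  rewrite !mxE mulr1n => c0; rewrite -/(v c p o) nAv nv c0 conjC0 !scale0r addr0 subr0.
  have h3 := nsq_ge0 (q *m p^t* - o *m s^t*).
  have := H1 p; rewrite -subr_ge0 => h1; have := H2 o; rewrite -subr_ge0 => h2.
  rewrite -subr_ge0.
  have -> : t * (0 * 0 + nsq p + nsq o) -
    ((ip s p + ip o q) * (ip p s + ip q o) + nsq (N *m p) + nsq (N^t* *m o)) =
   ((t - nsq q) * nsq p - (ip s p * ip p s + nsq (N *m p))) +
   ((t - nsq s) * nsq o - (ip q o * ip o q + nsq (N^t* *m o))) +
   nsq (q *m p^t* - o *m s^t*).
    rewrite nsqB !nsq_rank1 !ip_rank1; ring.
  exact: addr_ge0 (addr_ge0 h1 h2) h3.
by move=> c p o; rewrite -nAv -nv; apply: antisymmetric_norm_le AT t0 H _.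
Qed.

(** * The bound for a pair of unit vectors *)

(* The least such [t] is the sum of the squares of the two largest singular values
   of [K] (for [m > 1]); the second condition bounds the sum of [|K f|^2] and
   [|K w|^2] for orthonormal [f] and [w]. *)
Definition wedge_bounded m n (K : 'M[C]_(n, m)) (t : C) : Prop :=
  (forall f : 'cV[C]_m, nsq (K *m f) <= t * nsq f) /\
  (forall f w : 'cV[C]_m, ip f w = 0 ->
    nsq (K *m f) * nsq w + nsq (K *m w) * nsq f <= t * (nsq f * nsq w)).

Section Pure.
Context {m n : nat} (K : 'M[C]_(n, m)) (t : C).
Context (f : 'cV[C]_m) (g : 'cV[C]_n).
Hypotheses (f1 : nsq f = 1) (g1 : nsq g = 1).
Hypotheses (HK : wedge_bounded K t) (HKa : wedge_bounded (K^t*) t).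

Let kf := K *m f.
Let kg := K^t* *m g.
Let a := ip g kf.

(** This is [skew_block_norm_le] for the components [s] of [kg] orthogonal to [f] and [q] of [kf]
    orthogonal to [g], and for the compression [N] of [K] to the orthogonal complements of [f] and
    [g]. *)
Lemma pure_core_bound c (p : 'cV[C]_m) (o : 'cV[C]_n) : ip f p = 0 -> ip g o = 0 ->
  (ip kg p + ip o kf) * (ip p kg + ip kf o)
  + nsq (K *m p + c^* *: kf - ip g (K *m p + c^* *: kf) *: g)
  + nsq (K^t* *m o - c *: kg - ip f (K^t* *m o - c *: kg) *: f)
  <= (t - a * a^*) * (c * c^* + nsq p + nsq o).
Proof.
move=> fp go.
have af : ip kf g = a^* by rewrite /a ip_conj.
have fkg : ip f kg = a^* by rewrite -af /kf ip_mulmxl.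
have kgf : ip kg f = a by rewrite -ip_conj fkg conjCK.
pose s := kg - a^* *: f; pose q := kf - a *: g.
pose N := (1%:M - g *m g^t*) *m K *m (1%:M - f *m f^t*).
have pr k (w v : 'cV[C]_k) : (1%:M - w *m w^t*) *m v = v - ip w v *: w.
  by rewrite mulmxBl mul1mx -mulmxA ip_scalar1 mul_mx_scalar.
have NE v : N *m v = K *m (v - ip f v *: f) - ip g (K *m (v - ip f v *: f)) *: g.
  by rewrite /N -!mulmxA !pr.
have NaE v : N^t* *m v = K^t* *m (v - ip g v *: g)
    - ip f (K^t* *m (v - ip g v *: g)) *: f.
  have prH k (w : 'cV[C]_k) : (1%:M - w *m w^t*)^t* = 1%:M - w *m w^t*.
    by rewrite adjmxD adjmxN adjmxM trmxCK trmx1 map_mx1.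
  by rewrite /N !adjmxM !prH -!mulmxA !pr.
have nq : nsq q = nsq kf - a * a^* by rewrite /q nsq_proj_compl // af.
have ns : nsq s = nsq kg - a * a^*.
  by rewrite /s -fkg nsq_proj_compl // kgf fkg mulrC.
have tf : nsq kf <= t by have := HK.1 f; rewrite f1 mulr1.
have tg : nsq kg <= t by have := HKa.1 g; rewrite g1 mulr1.
have aa : a * a^* <= nsq kf by rewrite -af; exact: Bessel1.
have := skew_block_norm_le (s := s) (q := q) (N := N) (t := t - a * a^*) _ _ _ c p o.
rewrite NE NaE fp go !scale0r !subr0.
have -> : ip s p = ip kg p by rewrite /s ipBl ipZl fp mulr0 subr0.
have -> : ip p s = ip p kg.
  by rewrite /s ipBr ipZr -(ip_conj f p) fp conjC0 mulr0 subr0.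
have -> : ip o q = ip o kf.
  by rewrite /q ipBr ipZr -(ip_conj g o) go conjC0 mulr0 subr0.
have -> : ip q o = ip kf o by rewrite /q ipBl ipZl go mulr0 subr0.
have -> : K *m p - ip g (K *m p) *: g + c^* *: q =
   K *m p + c^* *: kf - ip g (K *m p + c^* *: kf) *: g.
  rewrite /q scalerBr scalerA ipDr ipZr -/a scalerDl opprD.
  by rewrite !addrA; congr (_ - _); rewrite addrAC.
have -> : K^t* *m o - ip f (K^t* *m o) *: f - c *: s =
   K^t* *m o - c *: kg - ip f (K^t* *m o - c *: kg) *: f.
  rewrite /s scalerBr scalerA ipBr ipZr fkg scalerBl !opprB.
  by rewrite -!addrA; congr (_ + _); rewrite [LHS]addrC [X in X - _]addrC -addrA.
apply.
- by rewrite subr_ge0 (le_trans aa).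
(* The first summand restores the component of [K *m v1] along [g] that [N] removes, so the left
   side is |K v1|^2. The wedge condition for the orthogonal pair [f], [v1] bounds it. *)
- move=> v; rewrite NE; set v1 := v - _.
  have fv1 : ip f v1 = 0 by rewrite /v1 ipBr ipZr -/(nsq f) f1 mulr1 subrr.
  have -> : ip s v = ip g (K *m v1).
    rewrite /v1 /s mulmxBr ipBl ipBr ipZl -scalemxAr ipZr -/kf -/a conjCK.
    by rewrite /kg ip_mulmxl trmxCK mulrC.
  have -> : ip v s = ip (K *m v1) g.
    rewrite /v1 /s mulmxBr ipBl ipBr ipZr -scalemxAr ipZl -/kf af ip_conj.
    by rewrite /kg ip_mulmxl mulrC.
  rewrite nsq_proj_compl // addrC subrK.
  have := HK.2 _ _ fv1; rewrite f1 mulr1 mul1r -/kf -lerBrDl -mulrBl => h.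
  have -> : t - a * a^* - nsq q = t - nsq kf by rewrite nq; ring.
  apply: le_trans h _; apply: ler_wpM2l; first by rewrite subr_ge0.
  by rewrite /v1 nsq_proj_compl // gerBl -(ip_conj v f) -normCKC ?exprn_ge0.
- move=> v; rewrite NaE; set v1 := v - _.
  have fv1 : ip g v1 = 0 by rewrite /v1 ipBr ipZr -/(nsq g) g1 mulr1 subrr.
  have -> : ip q v = ip f (K^t* *m v1).
    rewrite /v1 /q mulmxBr ipBl ipBr ipZl -scalemxAr ipZr -/kg fkg.
    by rewrite /kf ip_mulmxl mulrC.
  have -> : ip v q = ip (K^t* *m v1) f.
    rewrite /v1 /q mulmxBr ipBl ipBr ipZr -scalemxAr ipZl -/kg kgf ip_conj.
    by rewrite /kf ip_mulmxl trmxCK mulrC.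
  rewrite nsq_proj_compl // addrC subrK.
  have := HKa.2 _ _ fv1; rewrite g1 mulr1 mul1r -/kg -lerBrDl -mulrBl => h.
  have -> : t - a * a^* - nsq s = t - nsq kg by rewrite ns; ring.
  apply: le_trans h _; apply: ler_wpM2l; first by rewrite subr_ge0.
  by rewrite /v1 nsq_proj_compl // gerBl -(ip_conj v g) -normCKC ?exprn_ge0.
Qed.

(* The matrix on the left is the image of (c, p, o, w, l) under the adjoint of the
   real linear map in X that is bounded in [pure_uncertainty_bound]. *)
Lemma pure_adjoint_bound c (p w : 'cV[C]_m) (o l : 'cV[C]_n) :
  ip f p = 0 -> ip f w = 0 -> ip g o = 0 -> ip g l = 0 ->
  nsq (f *m (K *m p + c^* *: kf)^t* + w *m kf^t*
       + (K^t* *m o - c *: kg) *m g^t* + kg *m l^t*)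
  <= t * (c * c^* + nsq p + nsq o + nsq w + nsq l).
Proof.
move=> fp fw go gl.
have core := pure_core_bound c fp go.
have h1 : nsq (K^t* *m l) <= (t - nsq kg) * nsq l.
  by have := HKa.2 _ _ gl; rewrite g1 mulr1 mul1r -/kg -lerBrDl -mulrBl.
have h2 : nsq (K *m w) <= (t - nsq kf) * nsq w.
  by have := HK.2 _ _ fw; rewrite f1 mulr1 mul1r -/kf -lerBrDl -mulrBl.
have h3 := Bessel1 (K^t* *m l - a^* *: p) f1.
have h4 := Bessel1 (K *m w - a *: o) g1.
pose z := a * c - ip l kf + ip g (K *m w).
have h5 : 0 <= z * z^* by rewrite mul_conjC_ge0.
have af : ip kf g = a^* by rewrite /a ip_conj.
have fkg : ip f kg = a^* by rewrite -af /kf ip_mulmxl.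
have kgf : ip kg f = a by rewrite -ip_conj fkg conjCK.
have pf : ip p f = 0 by rewrite -ip_conj fp conjC0.
have wf : ip w f = 0 by rewrite -ip_conj fw conjC0.
have og : ip o g = 0 by rewrite -ip_conj go conjC0.
have lg : ip l g = 0 by rewrite -ip_conj gl conjC0.
(* The difference of the two sides is the sum of the slacks of [core], [h1], [h2],
   [h3], [h4] and of [z * z^*]. *)
move: core h1 h2 h3 h4; rewrite -subr_ge0 => core; rewrite -subr_ge0 => h1.
rewrite -subr_ge0 => h2; rewrite -subr_ge0 => h3; rewrite -subr_ge0 => h4.
rewrite -subr_ge0; set rhs := (X in 0 <= X).
move: (addr_ge0 (addr_ge0 (addr_ge0 (addr_ge0 (addr_ge0 core h1) h2) h3) h4) h5).
set lhs := (X in 0 <= X); suff -> : lhs = rhs by [].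
rewrite {}/lhs {}/rhs {core h1 h2 h3 h4 h5}/z.
rewrite !nsq_proj_compl //.
rewrite /nsq !(ipDl, ipBl, ipNl, ipDr, ipBr, ipNr, ipZl, ipZr, ip_rank1).
have E1 : ip w (K^t* *m o) = ip (K *m w) o by rewrite ip_mulmxl.
have E2 : ip (K^t* *m o) w = ip o (K *m w) by rewrite -ip_conj E1 ip_conj.
have E3 : ip w kg = ip (K *m w) g by rewrite ip_mulmxl.
have E4 : ip kg w = ip g (K *m w) by rewrite -ip_conj E3 ip_conj.
have E5 : ip l (K *m p) = ip (K^t* *m l) p by rewrite ip_mulmxl trmxCK.
have E6 : ip (K *m p) l = ip p (K^t* *m l) by rewrite -ip_conj E5 ip_conj.
have E7 : ip l kf = ip (K^t* *m l) f by rewrite ip_mulmxl trmxCK.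
have E8 : ip kf l = ip f (K^t* *m l) by rewrite -ip_conj E7 ip_conj.
have E9 : ip g (K *m p) = ip kg p by rewrite ip_mulmxl trmxCK.
have E10 : ip (K *m p) g = ip p kg by rewrite -ip_conj E9 ip_conj.
have E11 : ip f (K^t* *m o) = ip kf o by rewrite ip_mulmxl.
have E12 : ip (K^t* *m o) f = ip o kf by rewrite -ip_conj E11 ip_conj.
rewrite !(E1, E2, E3, E4, E5, E6, E7, E8, E9, E10, E11, E12).
rewrite !(rmorphD, rmorphB, rmorphN, rmorphM) /= !conjCK !ip_conj -/a.
rewrite !(af, fkg, kgf, fp, fw, go, gl, pf, wf, og, lg) -!/(nsq _) f1 g1.
ring.
Qed.
End Pure.

(** Duality: the vectors [w], [p], [o], [l] and the scalar [c] are chosen so that the matrix [Z] of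
    [pure_adjoint_bound] has [ip Z X] equal to the left side [S]. Since |Z|^2 <= t S, expanding 0 <=
    |Z - t X|^2 gives S <= t |X|^2. *)
Lemma pure_uncertainty_bound m n (X : 'M[C]_(m, n)) (K : 'M[C]_(n, m)) (t : C)
    (f : 'cV[C]_m) (g : 'cV[C]_n) :
  0 < t -> wedge_bounded K t -> wedge_bounded (K^t*) t ->
  nsq f = 1 -> nsq g = 1 ->
  nsq (X *m K *m f) + nsq ((X *m K)^t* *m f)
    + nsq (K *m X *m g) + nsq ((K *m X)^t* *m g)
    - (ip f (X *m K *m f) + ip g (K *m X *m g))
      * (ip f (X *m K *m f) + ip g (K *m X *m g))^* <= t * nsq X.
Proof.
move=> t0 HK HKa f1 g1.
set U := X *m K; set V := K *m X.
set u := ip f (U *m f); set v := ip g (V *m g); set s := u + v.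
have fUf : ip (U *m f) f = u^* by rewrite ip_conj.
have gVg : ip (V *m g) g = v^* by rewrite ip_conj.
have fUaf : ip f (U^t* *m f) = u^* by rewrite -ip_mulmxl.
have gVag : ip g (V^t* *m g) = v^* by rewrite -ip_mulmxl.
have Uaff : ip (U^t* *m f) f = u by rewrite -ip_conj fUaf conjCK.
have Vagg : ip (V^t* *m g) g = v by rewrite -ip_conj gVag conjCK.
pose w := U *m f - u *: f; pose p := U^t* *m f - u^* *: f.
pose o := V *m g - v *: g; pose l := V^t* *m g - v^* *: g.
have fw : ip f w = 0 by rewrite /w ipBr ipZr -/(nsq f) f1 mulr1 subrr.
have fp : ip f p = 0 by rewrite /p ipBr ipZr -/(nsq f) f1 mulr1 fUaf subrr.
have go : ip g o = 0 by rewrite /o ipBr ipZr -/(nsq g) g1 mulr1 subrr.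
have gl : ip g l = 0 by rewrite /l ipBr ipZr -/(nsq g) g1 mulr1 gVag subrr.
have nw : nsq w = nsq (U *m f) - u * u^* by rewrite nsq_proj_compl // fUf.
have np : nsq p = nsq (U^t* *m f) - u * u^*.
  by rewrite /p -fUaf nsq_proj_compl // fUaf Uaff mulrC.
have no : nsq o = nsq (V *m g) - v * v^* by rewrite nsq_proj_compl // gVg.
have nl : nsq l = nsq (V^t* *m g) - v * v^*.
  by rewrite /l -gVag nsq_proj_compl // gVag Vagg mulrC.
have fUp : ip f (U *m p) = nsq p.
  have -> : ip f (U *m p) = ip (U^t* *m f) p by rewrite ip_mulmxl trmxCK.
  by rewrite -[U^t* *m f](subrK (u^* *: f)) -/p ipDl ipZl fp mulr0 addr0.
have wUf : ip w (U *m f) = nsq w.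
  rewrite -[U *m f](subrK (u *: f)) -/w ipDr ipZr -(ip_conj f w) fw conjC0.
  by rewrite mulr0 addr0.
have oVg : ip o (V *m g) = nsq o.
  rewrite -[V *m g](subrK (v *: g)) -/o ipDr ipZr -(ip_conj g o) go conjC0.
  by rewrite mulr0 addr0.
have gVl : ip g (V *m l) = nsq l.
  have -> : ip g (V *m l) = ip (V^t* *m g) l by rewrite ip_mulmxl trmxCK.
  by rewrite -[V^t* *m g](subrK (v^* *: g)) -/l ipDl ipZl gl mulr0 addr0.
(* This choice uses |u - v|^2 - 2|u|^2 - 2|v|^2 = -|u + v|^2, where the subtracted squares come from
   the norms of [w], [p], [o] and [l]. *)
pose c := u - v; have cE : c = u - v by []; clearbody w p o l c.
have := pure_adjoint_bound f1 g1 HK HKa c fp fw go gl.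
set Z := (X in nsq X); set S := (X in t * X) => HS.
have ZX : ip Z X = S.
  rewrite /Z 3!ipDl !ip_rank1l mulmxDr -scalemxAr ipDr ipZr ipBl ipZl.
  rewrite !ip_mulmxl !trmxCK !mulmxA -/U -/V fUp wUf oVg gVl.
  rewrite -/u -/v /S cE rmorphB /=; ring.
have XZ : ip X Z = S.
  rewrite -ip_conj ZX /S !(rmorphD, rmorphM) /= conjCK [c^* * c]mulrC.
  by rewrite /nsq !ip_conj.
have := nsq_ge0 (Z - t *: X); rewrite nsqB nsqZ ipZr ipZl ZX XZ.
have -> : t^* = t by apply/conj_Creal/ger0_real/ltW.
move=> h.
have {}h : 0 <= t * (t * nsq X - S).
  have -> : t * (t * nsq X - S) = (nsq Z + t * t * nsq X - (t * S + t * S))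
     + (t * S - nsq Z) by ring.
  by rewrite addr_ge0 // subr_ge0.
move: h; rewrite pmulr_rge0 // subr_ge0; apply: le_trans.
suff -> : S = nsq (U *m f) + nsq (U^t* *m f) + nsq (V *m g) + nsq (V^t* *m g)
  - s * s^* by [].
rewrite /S nw np no nl /s cE !(rmorphD, rmorphB) /=; ring.
Qed.

(** * Reduction to rank one states *)

(** One complex equation amounts to two real ones in three real unknowns, so a nonzero solution
    exists. If |p| and |q| differ, Cramer's rule gives it with [t = D]; otherwise [t = 0] works. *)
Lemma real_zero_of_conj_equation (k p q : C) :
  exists t z, [/\ t \is Num.real, (t != 0) || (z != 0) & t * k + z * p + z^* * q = 0].
Proof.
pose D := p * p^* - q * q^*.
have Dr : D \is Num.real by rewrite rpredB // -normCK realX ?normr_real.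
have [D0|D0] := eqVneq D 0; last first.
  exists D, (- (k * p^* - k^* * q)); split; rewrite ?D0 //.
  by rewrite !(rmorphN, rmorphB, rmorphM) /= !conjCK /D; ring.
exists 0; have [p0|p0] := eqVneq p 0.
  exists 1; split; rewrite ?real0 ?oner_eq0 ?orbT //.
  move: D0; rewrite /D p0 mul0r sub0r => /eqP.
  by rewrite oppr_eq0 mul_conjC_eq0 => /eqP ->; rewrite !mulr0 mul0r !addr0.
(* As |p| = |q|, this root has modulus 1, and multiplying the equation by [z] turns it into z^2 p +
   q = 0. *)
pose z := sqrtC (- q / p); exists z.
have zz : z ^+ 2 = - q / p by rewrite sqrtCK.
have z1 : z * z^* = 1.
  have : (z * z^*) ^+ 2 = 1.
    rewrite exprMn -rmorphXn /= zz !(rmorphM, rmorphN) /= fmorphV.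
    have pp : p * p^* != 0 by rewrite mul_conjC_eq0.
    have E : q * q^* = p * p^* by apply/esym/eqP; rewrite -subr_eq0 -/D D0.
    rewrite -[RHS](divff pp) -{1}E.
    have pc : p^* != 0 by rewrite conjC_eq0.
    by field; rewrite p0 pc.
  move=> /eqP; rewrite sqrf_eq1 => /orP[/eqP //|/eqP E].
  by have := mul_conjC_ge0 z; rewrite E oppr_ge0 => /(lt_le_trans ltr01); rewrite ltxx.
have z0 : z != 0.
  by apply: contra_eq_neq z1 => ->; rewrite mul0r eq_sym oner_eq0.
split; rewrite ?real0 ?z0 ?orbT //.
rewrite mul0r add0r; apply: (mulfI z0).
by rewrite mulrDr !mulrA z1 mul1r mulr0 -expr2 zz divfK // addNr.
Qed.

(** Let d be the Hermitian 2x2 matrix with diagonal [x], [y] and off-diagonal entry [z]; its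
    determinant is negative. Then det(1 + e d) = 1 + S e - L e^2 has a positive root. At that root
    the trace stays positive and the determinant vanishes, so 1 + e d is positive semidefinite. *)
Lemma psd2_boundary (x y z : C) :
  x \is Num.real -> y \is Num.real -> 0 < z * z^* - x * y ->
  exists e, [/\ 0 < e, (1 + e * x) * (1 + e * y) = e ^+ 2 * (z * z^*),
    0 <= 1 + e * x & 0 <= 1 + e * y].
Proof.
move=> xr yr; set L := _ - _ => L0; pose S := x + y.
have Sr : S \is Num.real by rewrite rpredD.
have d0 : 0 < S ^+ 2 + L *+ 4.
  by rewrite ltr_wpDl ?pmulrn_lgt0 // real_exprn_even_ge0.
pose r := sqrtC (S ^+ 2 + L *+ 4).
have r0 : 0 < r by rewrite sqrtC_gt0.
have rr : r ^+ 2 = S ^+ 2 + L *+ 4 by rewrite sqrtCK.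
have Sr0 : 0 < S + r.
  have : `|S| < r.
    rewrite -(ltr_pXn2r (isT : (0 < 2)%N)) ?nnegrE ?normr_ge0 ?(ltW r0) //.
    by rewrite real_normK // rr ltrDl pmulrn_lgt0.
  by rewrite real_ltr_norml // => /andP[+ _]; rewrite -subr_gt0 opprK.
pose e := (S + r) / (L *+ 2).
have L20 : 0 < L *+ 2 by rewrite pmulrn_lgt0.
have e0 : 0 < e by rewrite divr_gt0.
have eE : L * e ^+ 2 = 1 + S * e.
  have Ln : L != 0 by apply: lt0r_neq0.
  rewrite /e; apply: (mulfI Ln); apply: (@mulfI _ 4%:R); first by rewrite pnatr_eq0.
  have -> : 4 * (L * (L * ((S + r) / (L *+ 2)) ^+ 2)) = S ^+ 2 + S * r *+ 2 + r ^+ 2.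
    field; rewrite ?mulrn_eq0 ?Ln //.
  rewrite rr; field; rewrite ?mulrn_eq0 ?Ln //.
have prodE : (1 + e * x) * (1 + e * y) = e ^+ 2 * (z * z^*).
  have -> : (1 + e * x) * (1 + e * y) = (1 + S * e) + e ^+ 2 * (x * y) by rewrite /S; ring.
  by rewrite -eE /L; ring.
have sum0 : 0 < (1 + e * x) + (1 + e * y).
  have -> : (1 + e * x) + (1 + e * y) = 1 + (1 + S * e) by rewrite /S; ring.
  by rewrite -eE ltr_wpDr ?ltr01 // mulr_ge0 ?(ltW L0) ?exprn_ge0 ?(ltW e0).
have prod0 : 0 <= (1 + e * x) * (1 + e * y).
  by rewrite prodE mulr_ge0 ?mul_conjC_ge0 ?exprn_ge0 ?(ltW e0).
have er : e \is Num.real by rewrite gtr0_real.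
have nn (a b : C) : a \is Num.real -> 0 <= a * b -> 0 < a + b -> 0 <= a.
  move=> ar ab s0; case: (real_leP (real0 C) ar) => // a0.
  move: ab; rewrite nmulr_rge0 // => b0.
  by have := lt_trans s0 (ltr_nwDl (lt_le_trans a0 (lexx _)) b0); rewrite ltxx.
have xr' : 1 + e * x \is Num.real by apply: realD; [exact: real1 | exact: realM].
have yr' : 1 + e * y \is Num.real by apply: realD; [exact: real1 | exact: realM].
exists e; split => //; first exact: nn xr' prod0 sum0.
by apply: nn yr' _ _; [rewrite mulrC; exact: prod0 | rewrite addrC; exact: sum0].
Qed.

Lemma psd2_rank1 (x y z : C) : 0 <= x -> 0 <= y -> x * y = z * z^* ->
  exists a b, [/\ a * a^* = x, b * b^* = y & a^* * b = z].
Proof.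
move=> x0 y0 E.
have sq (r : C) : 0 <= r -> sqrtC r * (sqrtC r)^* = r.
  by move=> r0; rewrite -normCK ger0_norm ?sqrtC_ge0 // sqrtCK.
have [xz|xn] := eqVneq x 0.
  exists 0, (sqrtC y); rewrite mul0r sq // xz; split => //.
  move: E; rewrite xz mul0r => /esym/eqP; rewrite mul_conjC_eq0 => /eqP ->.
  by rewrite conjC0 mul0r.
have an : sqrtC x != 0 by rewrite sqrtC_eq0.
have ac : (sqrtC x)^* = sqrtC x by apply/conj_Creal/ger0_real; rewrite sqrtC_ge0.
exists (sqrtC x), (z / sqrtC x); rewrite sq //; split => //.
  rewrite rmorphM /= fmorphV /= ac mulrACA -E -invfM -expr2 sqrtCK mulrC mulrA.
  by rewrite mulVf // mul1r.
by rewrite ac mulrCA divff // mulr1.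
Qed.

Lemma form_comb n (M : 'M[C]_n) (a b : C) (v w : 'cV[C]_n) :
  ip (a *: v + b *: w) (M *m (a *: v + b *: w)) =
  a * a^* * ip v (M *m v) + b * b^* * ip w (M *m w)
  + a^* * b * ip v (M *m w) + (a^* * b)^* * ip w (M *m v).
Proof.
rewrite mulmxDr -!scalemxAr !(ipDl, ipDr, ipZl, ipZr) rmorphM /= conjCK; ring.
Qed.

(* A positive semidefinite 2x2 matrix [1 + e d] with the three real linear
   constraints on [d] prescribed by the norm and by [U]: moving along [d] until
   the matrix becomes singular gives the rank one matrix of [a v + b w]. *)
Lemma merge_orthogonal n (U H : 'M[C]_n) (v w : 'cV[C]_n) :
  H^t* = H -> ip v w = 0 ->
  exists a b, let x := a *: v + b *: w in
    [/\ nsq x = nsq v + nsq w,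
        ip x (U *m x) = ip v (U *m v) + ip w (U *m w) &
        ip v (H *m v) + ip w (H *m w) <= ip x (H *m x)].
Proof.
move=> HH vw; have wv : ip w v = 0 by rewrite -ip_conj vw conjC0.
have [->|v0] := eqVneq v 0.
  exists 0, 1; rewrite /= scale0r add0r scale1r mulmx0.
  have z0 k (Z : 'cV[C]_k) : ip Z 0 = 0 by rewrite -(scale0r 0) ipZr mul0r.
  by rewrite /nsq !z0 mulmx0 !z0 !add0r.
have [->|w0] := eqVneq w 0.
  exists 1, 0; rewrite /= scale0r addr0 scale1r mulmx0.
  have z0 k (Z : 'cV[C]_k) : ip Z 0 = 0 by rewrite -(scale0r 0) ipZr mul0r.
  by rewrite /nsq !z0 mulmx0 !z0 !addr0.
have gv := nsq_gt0 v0; have gw := nsq_gt0 w0.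
have gvr : nsq v \is Num.real by rewrite gtr0_real.
have gwr : nsq w \is Num.real by rewrite gtr0_real.
pose h x y z := x * ip v (H *m v) + y * ip w (H *m w)
  + z * ip v (H *m w) + z^* * ip w (H *m v).
have Hr (x : 'cV[C]_n) : ip x (H *m x) \is Num.real.
  by apply/CrealP; rewrite ip_conj ip_mulmxl HH.
have [x [y [z [xr yr zL [cn cU ch]]]]] : exists x y z,
  [/\ x \is Num.real, y \is Num.real, 0 < z * z^* - x * y &
   [/\ x * nsq v + y * nsq w = 0,
   x * ip v (U *m v) + y * ip w (U *m w)
     + z * ip v (U *m w) + z^* * ip w (U *m v) = 0 &
   0 <= h x y z]].
  (* Taking x = t |w|^2 and y = -t |v|^2 solves the norm constraint and leaves a single complex
     equation in [t] and [z]. *)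
  have [t [z [tr tz E]]] := real_zero_of_conj_equation
    (nsq w * ip v (U *m v) - nsq v * ip w (U *m w))
    (ip v (U *m w)) (ip w (U *m v)).
  have L0 : 0 < z * z^* + nsq v * nsq w * t ^+ 2.
    have t2 : 0 <= t ^+ 2 by rewrite real_exprn_even_ge0.
    have vw0 : 0 < nsq v * nsq w by rewrite mulr_gt0.
    case/orP: tz => [tn|zn].
      rewrite ltr_wpDl ?mul_conjC_ge0 // mulr_gt0 // lt_def t2 andbT.
      by rewrite expf_eq0 /= tn.
    by rewrite ltr_pwDl ?mul_conjC_gt0 // mulr_ge0 // ltW.
  have hr : h (nsq w * t) (- (nsq v * t)) z \is Num.real.
    have zz : z * ip v (H *m w) + z^* * ip w (H *m v) \is Num.real.
      apply/CrealP; rewrite rmorphD !rmorphM /= conjCK !ip_conj !ip_mulmxl HH.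
      by rewrite addrC.
    rewrite /h -addrA; apply: realD => //.
    by apply: realD; apply: realM => //; rewrite ?realN; apply: realM.
  (* The constraints are linear and the determinant is even, so the direction may be reversed to
     make [h] nonnegative. *)
  have [h0|h0] := real_leP (real0 C) hr.
    exists (nsq w * t), (- (nsq v * t)), z; split; rewrite ?realN ?realM //.
      by move: L0; congr (0 < _); ring.
    by split => //; [ring | rewrite -[RHS]E; ring].
  exists (- (nsq w * t)), (nsq v * t), (- z); split; rewrite ?realN ?realM //.
    by rewrite rmorphN /=; move: L0; congr (0 < _); ring.
  split; [by ring | by rewrite rmorphN /= -[RHS]oppr0 -[in RHS]E; ring |].
  suff -> : h (- (nsq w * t)) (nsq v * t) (- z) = - h (nsq w * t) (- (nsq v * t)) z.
    by rewrite oppr_ge0 ltW.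
  by rewrite /h rmorphN /=; ring.
have [e [e0 eE ex ey]] := psd2_boundary xr yr zL.
have ec : e^* = e by apply/conj_Creal/gtr0_real.
have [a [b [aa bb ab]]] : exists a b, [/\ a * a^* = 1 + e * x,
    b * b^* = 1 + e * y & a^* * b = e * z].
  by apply: psd2_rank1 => //; rewrite eE rmorphM /= ec; ring.
exists a, b => /=.
have nE : nsq (a *: v + b *: w) = nsq v + nsq w.
  rewrite nsqD !nsqZ ipZl !ipZr ipZl vw wv aa bb !mulr0 !addr0.
  rewrite -[RHS]addr0 -(mulr0 e) -cn; ring.
have fE M : ip (a *: v + b *: w) (M *m (a *: v + b *: w)) =
   ip v (M *m v) + ip w (M *m w) + e * (x * ip v (M *m v) + y * ip w (M *m w)
     + z * ip v (M *m w) + z^* * ip w (M *m v)).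
  by rewrite form_comb aa bb ab rmorphM /= ec; ring.
split => //; first by rewrite fE cU mulr0 addr0.
by rewrite fE -/(h x y z) lerDl mulr_ge0 ?(ltW e0).
Qed.

(** Vectors are merged one at a time. The first conclusion carries the induction: the merged vector
    stays orthogonal to each vector not yet merged. *)
Lemma merge_orthogonal_family n (I : eqType) (r : seq I) (v : I -> 'cV[C]_n)
    (U H : 'M[C]_n) :
  H^t* = H -> uniq r ->
  {in r &, forall i j, i != j -> ip (v i) (v j) = 0} ->
  exists x, [/\ forall y, {in r, forall i, ip (v i) y = 0} -> ip x y = 0,
    nsq x = \sum_(i <- r) nsq (v i),
    ip x (U *m x) = \sum_(i <- r) ip (v i) (U *m v i) &
    \sum_(i <- r) ip (v i) (H *m v i) <= ip x (H *m x)].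
Proof.
move=> HH; elim: r => [|i r IH] /=.
  move=> _ _; exists 0; rewrite !big_nil !mulmx0 /nsq.
  have z0 (Z : 'cV[C]_n) : ip 0 Z = 0 by rewrite -(scale0r 0) ipZl conjC0 mul0r.
  by rewrite z0; split.
move=> /andP[ir ur] o.
have [|y [yo yn yU yH]] := IH ur.
  by move=> j k jr kr; apply: o; rewrite inE ?jr ?kr orbT.
have iy : ip (v i) y = 0.
  rewrite -ip_conj yo ?conjC0 // => j jr; apply: o.
  - by rewrite inE jr orbT.
  - by rewrite inE eqxx.
  - by apply: contraNneq ir => <-.
have [a [b /= [xn xU xH]]] := merge_orthogonal U HH iy.
exists (a *: v i + b *: y); rewrite !big_cons -yn -yU; split => //.
  move=> z Hz; rewrite ipDl !ipZl Hz ?inE ?eqxx // yo ?mulr0 ?addr0 //.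
  by move=> j jr; apply: Hz; rewrite inE jr orbT.
by apply: le_trans xH; rewrite lerD2l.
Qed.

Lemma ip_cols m n (Y Z : 'M[C]_(m, n)) : ip Y Z = \sum_j ip (col j Y) (col j Z).
Proof.
rewrite ipE; apply: eq_bigr => j _; rewrite ipE big_ord1.
by apply: eq_bigr => i _; rewrite !mxE.
Qed.

(* Replaces the density [Y *m Y^t*] by a pure state: an extreme point of the
   states satisfying the two real linear constraints given by [U]. *)
Lemma exists_pure_vector m n (Y : 'M[C]_(m, n)) (U : 'M[C]_m) :
  exists x : 'cV[C]_m, [/\ nsq x = nsq Y, ip x (U *m x) = ip Y (U *m Y) &
    nsq (U *m Y) + nsq (U^t* *m Y) <= nsq (U *m x) + nsq (U^t* *m x)].
Proof.
have YY : (Y^t* *m Y)^t* = Y^t* *m Y by rewrite adjmxM trmxCK.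
have [G [d [GG GG' E _]]] := hermitian_spectral YY.
(* Diagonalizing Y' Y makes the columns of [Z] orthogonal, while Z Z' = Y Y' leaves every form
   [ip Y (M *m Y)] unchanged. *)
pose Z := Y *m G^t*.
have ZE M : ip Z (M *m Z) = ip Y (M *m Y).
  by rewrite /Z ip_mulmxr trmxCK -!mulmxA GG' mulmx1.
have cZ M j : col j (M *m Z) = M *m col j Z by rewrite !colE mulmxA.
have o : {in index_enum 'I_n &, forall i j, i != j -> ip (col i Z) (col j Z) = 0}.
  move=> i j _ _ ij.
  have -> : ip (col i Z) (col j Z) = (Z^t* *m Z) i j.
    by rewrite ipE big_ord1 mxE; apply: eq_bigr => k _; rewrite !mxE.
  rewrite /Z adjmxM trmxCK -mulmxA (mulmxA _ Y) E -!mulmxA GG mulmx1 mulmxA GG mul1mx.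
  by rewrite !mxE (negPf ij) mulr0n.
pose H := U^t* *m U + U *m U^t*.
have HH : H^t* = H by rewrite /H adjmxD !adjmxM !trmxCK.
have HE k (W : 'M[C]_(m, k)) : ip W (H *m W) = nsq (U *m W) + nsq (U^t* *m W).
  by rewrite /H mulmxDl ipDr /nsq !ip_mulmxl trmxCK -!mulmxA.
have [x [_ xn xU xH]] := merge_orthogonal_family U HH (index_enum_uniq _) o.
exists x; split.
- by have := ZE 1%:M; rewrite !mul1mx ip_cols xn.
- by rewrite xU -ZE ip_cols; apply: eq_bigr => j _; rewrite cZ.
rewrite -!HE -ZE; apply: le_trans xH; rewrite ip_cols.
by apply: ler_sum => j _; rewrite cZ.
Qed.

(** * The weighted commutator inequality *)

Lemma generalized_Bottcher_Wenzel m n (X Y : 'M[C]_(m, n)) (K : 'M[C]_(n, m)) t :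
  0 < t -> wedge_bounded K t -> wedge_bounded (K^t*) t ->
  nsq (X *m K *m Y - Y *m K *m X) <= t * (nsq X * nsq Y).
Proof.
move=> t0 HK HKa.
wlog Y1 : Y / nsq Y = 1 => [hw|].
  have [->|Y0] := eqVneq Y 0.
    have n0 : nsq (0 : 'M[C]_(m, n)) = 0.
      by rewrite -(scale0r 0) nsqZ !mul0r.
    by rewrite mulmx0 !mul0mx subr0 n0 !mulr0.
  have gY := nsq_gt0 Y0; pose r := sqrtC (nsq Y).
  have r0 : r != 0 by rewrite sqrtC_eq0 lt0r_neq0.
  have rr : r * r^* = nsq Y.
    by rewrite -normCK ger0_norm ?sqrtC_ge0 ?ltW // sqrtCK.
  have YE : Y = r *: (r^-1 *: Y) by rewrite scalerA divff // scale1r.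
  have h1 : nsq (r^-1 *: Y) = 1.
    by rewrite nsqZ rmorphV ?unitfE // -invfM rr mulVf // lt0r_neq0.
  have := hw _ h1; rewrite h1 mulr1.
  move: YE h1; move: (r^-1 *: Y) => W YE h1 h.
  rewrite YE -!scalemxAr -!scalemxAl -scalerBr !nsqZ h1 mulr1.
  by rewrite [leRHS]mulrA [leRHS]mulrC; apply: ler_wpM2l h; exact: mul_conjC_ge0.
rewrite -(mulmxA Y) Y1 mulr1; set U := X *m K; set V := K *m X.
have [f [fn fU fH]] := exists_pure_vector Y U.
have [g [gn gV gH]] := exists_pure_vector (Y^t*) V.
rewrite Y1 in fn; rewrite nsq_adj Y1 in gn.
have := pure_uncertainty_bound X t0 HK HKa fn gn.
rewrite -/U -/V fU gV; apply: le_trans.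
have gV' : ip (Y^t*) (V *m Y^t*) = (ip Y (Y *m V^t*))^*.
  by rewrite ip_conj -ip_adj adjmxM trmxCK.
(* The cross terms of the two squares cancel after [U] and [V] are moved across the inner
   product. *)
have parallelogram : nsq (U *m Y - Y *m V) + nsq (U^t* *m Y + Y *m V^t*) =
  nsq (U *m Y) + nsq (U^t* *m Y) + (nsq (Y *m V) + nsq (Y *m V^t*)).
  have c1 : ip (U *m Y) (Y *m V) = ip (Y *m V^t*) (U^t* *m Y).
    by rewrite [RHS]ip_mulmxr trmxCK ip_mulmxl mulmxA.
  have c2 : ip (Y *m V) (U *m Y) = ip (U^t* *m Y) (Y *m V^t*).
    by rewrite -ip_conj c1 ip_conj.
  by rewrite nsqB nsqD c1 c2; ring.
have nadj (M : 'M[C]_n) : nsq (M *m Y^t*) = nsq (Y *m M^t*).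
  by rewrite -nsq_adj adjmxM trmxCK.
have cs := ip_CauchySchwarz Y (U^t* *m Y + Y *m V^t*).
rewrite Y1 mul1r ipDr in cs.
have sE : ip Y (U *m Y) + ip (Y^t*) (V *m Y^t*)
    = (ip Y (U^t* *m Y) + ip Y (Y *m V^t*))^*.
  by rewrite rmorphD /= -gV' ip_conj ip_mulmxl trmxCK.
have -> : nsq (U *m Y - Y *m V) = nsq (U *m Y) + nsq (U^t* *m Y)
  + (nsq (Y *m V) + nsq (Y *m V^t*)) - nsq (U^t* *m Y + Y *m V^t*).
  by rewrite -parallelogram addrK.
rewrite lerB //; last by rewrite sE conjCK mulrC.
move: gH; rewrite !nadj trmxCK [nsq (Y *m V^t*) + _]addrC => gH.
by rewrite -[leRHS]addrA lerD.
Qed.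

(** * Diagonal weights *)

(** Bessel's inequality for an orthogonal pair, cleared of denominators so that zero vectors are
    allowed. *)
Lemma Bessel2 n (f w e : 'cV[C]_n) : ip f w = 0 ->
  ip f e * ip e f * nsq w + ip w e * ip e w * nsq f <= nsq f * nsq w * nsq e.
Proof.
move=> fw; have wf : ip w f = 0 by rewrite -ip_conj fw conjC0.
have z0 (Z : 'cV[C]_n) : ip 0 Z = 0 by rewrite -(scale0r 0) ipZl conjC0 mul0r.
have [->|f0] := eqVneq f 0; first by rewrite /nsq !z0 !(mul0r, mulr0) addr0.
have [->|w0] := eqVneq w 0; first by rewrite /nsq !z0 !(mul0r, mulr0) addr0.
have F := nsq_gt0 f0; have W := nsq_gt0 w0.
have Fc : (nsq f)^* = nsq f by rewrite ip_conj.
have Wc : (nsq w)^* = nsq w by rewrite ip_conj.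
have := nsq_ge0
  ((nsq f * nsq w) *: e - (nsq w * ip f e) *: f - (nsq f * ip w e) *: w).
set x := (X in nsq X); have -> : nsq x = (nsq f * nsq w) * (nsq f * nsq w * nsq e -
      (ip f e * ip e f * nsq w + ip w e * ip e w * nsq f)).
  rewrite {1}/nsq /x !(ipBl, ipBr, ipZl, ipZr) fw wf !rmorphM /= Fc Wc !ip_conj.
  by rewrite -/(nsq f) -/(nsq w) -/(nsq e); ring.
by rewrite pmulr_rge0 ?mulr_gt0 // subr_ge0.
Qed.

Lemma nsq_cV n (v : 'cV[C]_n) : nsq v = \sum_i v i 0 * (v i 0)^*.
Proof. by rewrite nsq_sum big_ord1; apply: eq_bigr => i _; rewrite normCK. Qed.

Lemma nsq_diag n (k : 'rV[C]_n) (v : 'cV[C]_n) :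
  nsq (diag_mx k *m v) = \sum_i k 0 i * (k 0 i)^* * (v i 0 * (v i 0)^*).
Proof.
rewrite nsq_cV; apply: eq_bigr => i _; rewrite mul_diag_mx !mxE rmorphM /=; ring.
Qed.

(** The left side of the wedge condition is a sum of [mu i * c i], where the [c i] are nonnegative
    with total 2 F W. By [Bessel2] the largest weight [mu i0] receives at most F W; the rest is
    weighted by at most [mu i1]. *)
Lemma diag_wedge_bounded n (k : 'rV[C]_n) (i0 i1 : 'I_n) :
  let mu i := k 0 i * (k 0 i)^* in
  i0 != i1 -> (forall i, i != i0 -> mu i <= mu i1) -> mu i1 <= mu i0 ->
  wedge_bounded (diag_mx k) (mu i0 + mu i1).
Proof.
move=> mu i01 H1 H0.
have mu0 i : 0 <= mu i by rewrite mul_conjC_ge0.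
have mle i : mu i <= mu i0.
  by have [->//|/H1 h] := eqVneq i i0; apply: le_trans h H0.
split=> [f|f w fw].
  rewrite nsq_diag nsq_cV mulr_sumr; apply: ler_sum => i _.
  by rewrite ler_wpM2r ?mul_conjC_ge0 // (le_trans (mle i)) // lerDl.
rewrite !nsq_diag -/mu; set F := nsq f; set W := nsq w.
pose c i := f i 0 * (f i 0)^* * W + w i 0 * (w i 0)^* * F.
have c0 i : 0 <= c i.
  by apply: addr_ge0; apply: mulr_ge0; rewrite ?mul_conjC_ge0 ?nsq_ge0.
have cs : \sum_i c i = F * W + F * W.
  by rewrite big_split /= -!mulr_suml -!nsq_cV -/F -/W [W * F]mulrC.
have cF : c i0 <= F * W.
  have := Bessel2 (delta_mx i0 0) fw.
  have dE (v : 'cV[C]_n) : ip v (delta_mx i0 0) = (v i0 0)^*.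
    rewrite ipE big_ord1 (bigD1 i0) //= big1 ?addr0 ?mxE ?eqxx ?mulr1 // => j ji.
    by rewrite !mxE (negPf ji) mulr0.
  have -> : nsq (delta_mx i0 0 : 'cV[C]_n) = 1 by rewrite /nsq dE mxE !eqxx conjC1.
  rewrite -!(ip_conj _ (delta_mx i0 0)) !dE !conjCK mulr1; apply: le_trans.
  by rewrite /c ![_^* * _]mulrC.
have -> : (\sum_i mu i * (f i 0 * (f i 0)^*)) * W
    + (\sum_i mu i * (w i 0 * (w i 0)^*)) * F = \sum_i mu i * c i.
  by rewrite !mulr_suml -big_split; apply: eq_bigr => i _ /=; rewrite /c; ring.
have h : \sum_i mu i * c i <= mu i0 * c i0 + mu i1 * (F * W + F * W - c i0).
  rewrite -cs [X in _ * (X - _)](bigD1 i0) //= [c i0 + _]addrC addrK.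
  rewrite (bigD1 i0) //= lerD2l mulr_sumr; apply: ler_sum => i ii.
  by rewrite ler_wpM2r // H1.
apply: le_trans h _; rewrite -subr_ge0.
have -> : (mu i0 + mu i1) * (F * W)
    - (mu i0 * c i0 + mu i1 * (F * W + F * W - c i0)) = (mu i0 - mu i1) * (F * W - c i0) by ring.
by rewrite mulr_ge0 ?subr_ge0.
Qed.

(** * From norms to traces against the density matrix *)

Lemma nsq_density n (M S : 'M[C]_n) :
  nsq (M *m S) = \tr (M^t* *m M *m (S *m S^t*)).
Proof. by rewrite /nsq /ip adjmxM -mulmxA mxtrace_mulC !mulmxA. Qed.

(** With S S' = rho, the norms of [G *m A *m S] and [G *m B *m S] are the traces on the right.
    Taking [K = diag_mx k] with S K G = 1, the triple products collapse to [G *m (A *m B *m S)] and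
    its counterpart. The largest squared weights of [K] are the inverses of the smallest [d 0 i]. *)
Lemma commutator_trace_le n (G : 'M[C]_n) (d : 'rV[C]_n) (i0 i1 : 'I_n) rho A B :
  rho = G^t* *m diag_mx d *m G -> G^t* *m G = 1%:M -> G *m G^t* = 1%:M ->
  (forall i, 0 < d 0 i) ->
  i0 != i1 -> (forall i, i != i0 -> d 0 i1 <= d 0 i) -> d 0 i0 <= d 0 i1 ->
  A^t* = A -> B^t* = B ->
  \tr ((A *m B - B *m A)^t* *m (A *m B - B *m A) *m rho) <=
  ((d 0 i0)^-1 + (d 0 i1)^-1) * (\tr (A *m A *m rho) * \tr (B *m B *m rho)).
Proof.
move=> rhoE GG GG' d0 i01 H1 H0 AA BB.
pose k : 'rV[C]_n := \row_i (sqrtC (d 0 i))^-1.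
pose w : 'rV[C]_n := \row_i sqrtC (d 0 i).
have sc i : (sqrtC (d 0 i))^* = sqrtC (d 0 i).
  by apply/conj_Creal/ger0_real; rewrite sqrtC_ge0 ltW.
have sn i : sqrtC (d 0 i) != 0 by rewrite sqrtC_eq0 lt0r_neq0.
have kk i : k 0 i * (k 0 i)^* = (d 0 i)^-1.
  by rewrite !mxE fmorphV /= sc -invfM -expr2 sqrtCK.
have dV i j : d 0 i <= d 0 j -> (d 0 j)^-1 <= (d 0 i)^-1.
  by move=> h; rewrite lef_pV2 ?posrE.
have diagA (u : 'rV[C]_n) : (forall i, (u 0 i)^* = u 0 i) -> (diag_mx u)^t* = diag_mx u.
  move=> uc; rewrite tr_diag_mx; apply/matrixP => i j; rewrite !mxE rmorphMn /=.
  by rewrite uc.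
have wH : (diag_mx w)^t* = diag_mx w by apply: diagA => i; rewrite mxE sc.
have kH : (diag_mx k)^t* = diag_mx k by apply: diagA => i; rewrite mxE fmorphV /= sc.
have wk : diag_mx w *m diag_mx k = 1%:M.
  rewrite mulmx_diag -diag_const_mx; congr diag_mx; apply/rowP => i.
  by rewrite !mxE divff.
have HK : wedge_bounded (diag_mx k) ((d 0 i0)^-1 + (d 0 i1)^-1).
  rewrite -!kk; apply: diag_wedge_bounded => // [i ii|]; rewrite !kk dV ?H1 //.
pose S := G^t* *m diag_mx w.
have SS : S *m S^t* = rho.
  rewrite rhoE /S adjmxM trmxCK wH !mulmxA.
  rewrite -(mulmxA _ (diag_mx w) (diag_mx w)) mulmx_diag.
  by congr (_ *m diag_mx _ *m _); apply/rowP => i; rewrite !mxE -expr2 sqrtCK.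
have SkG : S *m (diag_mx k *m G) = 1%:M.
  by rewrite /S -mulmxA (mulmxA (diag_mx w)) wk mul1mx.
have HKa : wedge_bounded ((diag_mx k)^t*) ((d 0 i0)^-1 + (d 0 i1)^-1) by rewrite kH.
have t0 : 0 < (d 0 i0)^-1 + (d 0 i1)^-1 by rewrite addr_gt0 ?invr_gt0.
have := generalized_Bottcher_Wenzel (G *m A *m S) (G *m B *m S) t0 HK HKa.
clearbody S; have E (M N : 'M[C]_n) :
    G *m M *m S *m diag_mx k *m (G *m N *m S) = G *m (M *m N *m S).
  rewrite -!mulmxA (mulmxA (diag_mx k)) (mulmxA S).
  by rewrite SkG mul1mx.
by rewrite !E -mulmxBr -mulmxBl -!(mulmxA G) !(nsq_unitary _ GG) !nsq_density SS AA BB.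
Qed.

Lemma char_poly_unitary_conj n (G D : 'M[C]_n) :
  G *m G^t* = 1%:M -> G^t* *m G = 1%:M ->
  char_poly (G^t* *m D *m G) = char_poly D.
Proof.
move=> GG GG'; rewrite /char_poly /char_poly_mx.
have GGp : map_mx polyC (G^t*) *m map_mx polyC G = 1%:M.
  by rewrite -map_mxM GG' map_mx1.
have -> : 'X%:M - map_mx polyC (G^t* *m D *m G) =
   map_mx polyC (G^t*) *m ('X%:M - map_mx polyC D) *m map_mx polyC G.
  by rewrite mulmxBr mulmxBl mul_mx_scalar -scalemxAl GGp scalemx1 -!map_mxM.
rewrite !det_mulmx mulrAC -det_mulmx GGp det1 mul1r //.
Qed.
End HilbertSchmidt.

(** * The spectrum of the density matrix *)

Section Spectrum.
Context {R : realType}.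

(** Both lists contain the roots of the same characteristic polynomial, hence are permutations of
    each other before sorting. *)
Lemma eigenvaluesE n (X : 'M[R[i]]_n) (G : 'M[R[i]]_n) (d : 'rV[R[i]]_n) :
  G *m G^t* = 1%:M -> G^t* *m G = 1%:M -> X = G^t* *m diag_mx d *m G ->
  eigenvalues X = sort <=%R [seq complex.Re (d 0 i) | i <- enum 'I_n].
Proof.
move=> GG GG' ->; rewrite /eigenvalues.
case: closed_field_poly_normal => r /= E.
have pe : perm_eq r [seq d 0 i | i <- enum 'I_n].
  apply: prod_XsubC_eq; move: E.
  rewrite (monicP (char_poly_monic _)) scale1r => <-.
  rewrite char_poly_unitary_conj // char_poly_trig ?diag_mx_is_trig //.
  rewrite big_map big_enum; apply: eq_bigr => i _.
  by rewrite mxE eqxx mulr1n.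
have -> : [seq complex.Re (d 0 i) | i <- enum 'I_n]
    = [seq complex.Re z | z <- [seq d 0 i | i <- enum 'I_n]].
  by rewrite -map_comp.
apply/perm_sortP;
  by [exact: le_total | exact: le_trans | exact: le_anti | exact: perm_map].
Qed.

(** Indices are sorted instead of values, so that a repeated smallest value still yields two
    distinct indices. *)
Lemma two_smallest n (h : 'I_n -> R) : (2 <= n)%N ->
  let s := sort <=%R [seq h i | i <- enum 'I_n] in
  exists i0 i1, [/\ i0 != i1, s`_0 = h i0, s`_1 = h i1, h i0 <= h i1 &
    forall i, i != i0 -> h i1 <= h i].
Proof.
move=> n2 s.
pose le' := relpre h <=%R : rel 'I_n.
pose e := sort le' (enum 'I_n).
have n0 : (0 < n)%N by exact: ltn_trans n2.
pose x0 := Ordinal n0.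
have sE : s = [seq h i | i <- e] by rewrite /s sort_map.
have es : size e = n by rewrite size_sort size_enum_ord.
have tr : transitive le' by move=> x y z; apply: le_trans.
have rf : reflexive le' by move=> x; apply: lexx.
have so : sorted le' e by apply: sort_sorted => x y; apply: le_total.
have mono i j : (i <= j < n)%N -> h (nth x0 e i) <= h (nth x0 e j).
  move=> /andP[ij jn]; apply: (sorted_leq_nth tr rf x0 so) => //; rewrite inE es //.
  exact: leq_ltn_trans jn.
have u : uniq e by rewrite sort_uniq enum_uniq.
exists (nth x0 e 0), (nth x0 e 1); split.
- by rewrite nth_uniq ?es.
- by rewrite sE (nth_map x0) ?es.
- by rewrite sE (nth_map x0) ?es.
- exact: mono.
move=> i; have ie : i \in e by rewrite mem_sort mem_enum.
rewrite -{1 2}(nth_index x0 ie) => ne; apply: mono.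
have -> : (index i e < n)%N by rewrite -[X in (_ < X)%N]es index_mem.
by rewrite andbT lt0n; apply: contraNneq ne => ->.
Qed.
End Spectrum.

(** * Optimality of the constant *)

Section Optimality.
Context {R : realType} {n : nat} (G rho : 'M[R[i]]_n) (d : 'rV[R[i]]_n).
Hypotheses (GG : G *m G^t* = 1%:M)
  (rhoE : rho = G^t* *m diag_mx d *m G).

Let conjG (M : 'M[R[i]]_n) := G^t* *m M *m G.

Lemma conjG_mul M N : conjG M *m conjG N = conjG (M *m N).
Proof. by rewrite /conjG -!mulmxA (mulmxA G) GG mul1mx. Qed.

Lemma expectation_conjG M : expectation rho (conjG M) = \tr (M *m diag_mx d).
Proof. by rewrite /expectation rhoE conjG_mul /conjG mxtrace_mulC mulmxA GG mul1mx. Qed.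

Lemma trace_delta_diag i j :
  \tr (delta_mx i j *m diag_mx d) = if i == j then d 0 i else 0.
Proof.
rewrite mxtrace_mulC /mxtrace (bigD1 i) //= big1 => [|k ki].
  by rewrite addr0 mul_diag_mx !mxE eqxx andTb eq_sym; case: eqP; rewrite ?mulr1 ?mulr0.
by rewrite mul_diag_mx !mxE (negPf ki) mulr0.
Qed.

Lemma bound_le_of_eigenpair (b : R) i0 i1 :
  i0 != i1 -> (forall i, (d 0 i)^* = d 0 i) -> 0 < d 0 i0 + d 0 i1 ->
  uncertainty_bound rho b ->
  b%:C <= d 0 i0 * d 0 i1 / (d 0 i0 + d 0 i1).
Proof.
move=> i01 dc s0; set s := d 0 i0 + d 0 i1 in s0 * => H.
have i10 : i1 != i0 by rewrite eq_sym.
pose E i j : 'M[R[i]]_n := delta_mx i j.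
have EE i j k l : E i j *m E k l = if j == k then E i l else 0.
  by rewrite /E; case: eqP => [->|/eqP h]; rewrite ?mul_delta_mx ?mul_delta_mx_0.
have Et i j : (E i j)^t* = E j i by rewrite trmx_delta map_delta_mx.
(* Both have expectation zero: [A] is off-diagonal, and the weights in [B] make its two
   contributions cancel. The inequality then reads b s^3 <= s (d0 d1 s), with d0 and d1 the entries
   of [d] at [i0] and [i1]. *)
pose A := E i0 i1 + E i1 i0; pose B := d 0 i1 *: E i0 i0 - d 0 i0 *: E i1 i1.
have AA : A *m A = E i0 i0 + E i1 i1.
  rewrite mulmxDl !mulmxDr !EE !eqxx (negPf i01) (negPf i10).
  by rewrite add0r addr0.
have BB : B *m B = d 0 i1 ^+ 2 *: E i0 i0 + d 0 i0 ^+ 2 *: E i1 i1.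
  rewrite mulmxBl !mulmxBr -!scalemxAl -!scalemxAr !EE !eqxx (negPf i01) (negPf i10).
  by rewrite !scaler0 subr0 sub0r opprK !scalerA.
have CC : A *m B - B *m A = s *: (E i1 i0 - E i0 i1).
  rewrite /A /B !(mulmxBl, mulmxBr, mulmxDl, mulmxDr) -!scalemxAl -!scalemxAr.
  rewrite !EE !eqxx (negPf i01) (negPf i10) !scaler0 !(addr0, add0r, subr0, sub0r).
  by apply/matrixP => x y; rewrite /s !mxE; ring.
have herm M : M^t* = M -> conjG M \is hermsymmx.
  move=> MH; apply/is_hermitianmxP; rewrite expr0 scale1r.
  by rewrite /conjG !adjmxM trmxCK MH mulmxA.
have Ah : A^t* = A by rewrite adjmxD !Et addrC.
have Bh : B^t* = B by rewrite adjmxD adjmxN !adjmxZ !Et !dc.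
have tE i j : \tr (E i j *m diag_mx d) = if i == j then d 0 i else 0.
  exact: trace_delta_diag.
have var0 M : \tr (M *m diag_mx d) = 0 ->
    variance rho (conjG M) = \tr (M *m M *m diag_mx d).
  move=> M0; rewrite /variance expectation_conjG M0 raddf0 subr0 conjG_mul.
  exact: expectation_conjG.
have vA : variance rho (conjG A) = s.
  rewrite var0 ?AA mulmxDl linearD /= !tE ?eqxx //.
  by rewrite (negPf i01) (negPf i10) addr0.
have vB : variance rho (conjG B) = d 0 i0 * d 0 i1 * s.
  rewrite var0 ?BB mulmxDl linearD /= ?mulNmx ?linearN /= -!scalemxAl
    !linearZ /= !tE !eqxx.
    by rewrite /s; ring.
  by rewrite /GRing.scale /=; ring.
have vC : expectation rho (abs2mx (commutator (conjG A) (conjG B))) = s ^+ 3.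
  have -> : commutator (conjG A) (conjG B) = conjG (A *m B - B *m A).
    rewrite /commutator !conjG_mul; move: (A *m B) (B *m A) => M N.
    by rewrite /conjG mulmxBr mulmxBl.
  have -> : abs2mx (conjG (A *m B - B *m A)) =
      conjG ((A *m B - B *m A)^t* *m (A *m B - B *m A)).
    by rewrite -conjG_mul /abs2mx /conjG !adjmxM trmxCK !mulmxA.
  rewrite expectation_conjG CC adjmxZ adjmxD adjmxN !Et.
  have -> : s^* = s by rewrite /s rmorphD /= !dc.
  rewrite -!(scalemxAl, scalemxAr) scalerA.
  have -> : (E i0 i1 - E i1 i0) *m (E i1 i0 - E i0 i1) = E i0 i0 + E i1 i1.
    rewrite mulmxBl !mulmxBr !EE !eqxx (negPf i01) (negPf i10).
    by rewrite subr0 sub0r opprK.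
  by rewrite mulmxDl linearZ /= linearD /= !tE !eqxx -/s; ring.
have := H _ _ (herm _ Ah) (herm _ Bh); rewrite vA vB vC => h.
rewrite ler_pdivlMr // -(ler_pM2r (exprn_gt0 2 s0)).
by move: h; congr (_ <= _); ring.
Qed.
End Optimality.

(** * The sharp constant in terms of the two smallest eigenvalues *)

Theorem mainTheorem3 (R : realType) (d : nat) (rho : 'M[R[i]]_d) :
  (2 <= d)%N ->
  strictly_positive_density rho ->
  let lambda1 := (eigenvalues rho)`_0 in
  let lambda2 := (eigenvalues rho)`_1 in
  let b0 := lambda1 * lambda2 / (lambda1 + lambda2) in
  uncertainty_bound rho b0 /\
  (forall b : R, uncertainty_bound rho b -> b <= b0).
Proof.
move=> d2 [[rho_herm rho_pos] rho_tr] lambda1 lambda2 b0.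
have adjE (M : 'M[R[i]]_d) : M \is hermsymmx -> M^t* = M.
  by move/is_hermitianmxP; rewrite expr0 scale1r => <-.
have rhoH := adjE _ rho_herm.
have [G [D [GG GG' rhoE Dr]]] := hermitian_spectral rhoH.
have D0 i : 0 < D 0 i.
  pose v := G^t* *m (delta_mx i 0 : 'cV[R[i]]_d).
  have Gv : G *m v = delta_mx i 0 by rewrite mulmxA GG mul1mx.
  have v0 : v != 0.
    apply: contra_eq_neq Gv => ->; rewrite mulmx0 eq_sym.
    by apply/eqP => /matrixP/(_ i 0)/eqP; rewrite !mxE !eqxx oner_eq0.
  have := rho_pos v v0.
  have -> : v^t* *m rho *m v = (G *m v)^t* *m (diag_mx D *m (G *m v)).
    by rewrite rhoE adjmxM !mulmxA.
  rewrite Gv mxE (bigD1 i) //= big1 => [|j ji].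
    by rewrite mul_diag_mx !mxE !eqxx conjC1 mul1r mulr1 addr0.
  by rewrite mul_diag_mx !mxE (negPf ji) conjC0 mul0r.
pose h i := complex.Re (D 0 i).
have Dh i : D 0 i = (h i)%:C by rewrite /h RRe_real.
have h0 i : 0 < h i by rewrite -ltcR -Dh.
have [i0 [i1 [i01 s0 s1 h01 hi]]] := two_smallest h d2.
have l1 : lambda1 = h i0 by rewrite /lambda1 (eigenvaluesE GG GG' rhoE).
have l2 : lambda2 = h i1 by rewrite /lambda2 (eigenvaluesE GG GG' rhoE).
have b0E : b0%:C = D 0 i0 * D 0 i1 / (D 0 i0 + D 0 i1).
  by rewrite !Dh /b0 l1 l2 fmorph_div rmorphM rmorphD.
have Ds : 0 < D 0 i0 + D 0 i1 by rewrite addr_gt0.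
split=> [A B /adjE AH /adjE BH|b Hb]; last first.
  rewrite -lecR b0E; apply: (bound_le_of_eigenpair GG rhoE) => // i.
  exact/conj_Creal.
have expectation_real M : M^t* = M -> (expectation rho M)^* = expectation rho M.
  move=> MH; have -> : expectation rho M = ip M rho by rewrite /ip MH.
  by rewrite ip_conj /ip rhoH MH mxtrace_mulC.
pose cA := A - (expectation rho A)%:M; pose cB := B - (expectation rho B)%:M.
have center_adj M : M^t* = M ->
    (M - (expectation rho M)%:M)^t* = M - (expectation rho M)%:M.
  by move=> MH; rewrite adjmxD adjmxN MH tr_scalar_mx map_scalar_mx /= expectation_real.
(* Centering changes [A] and [B] by scalar matrices, which commute with everything. *)
have -> : commutator A B = cA *m cB - cB *m cA.
  rewrite /commutator /cA /cB !mulmxBl !mulmxBr !mul_scalar_mx !mul_mx_scalar.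
  by apply/matrixP => x y; rewrite !mxE; ring.
have D01 : D 0 i0 <= D 0 i1 by rewrite !Dh lecR.
have Di i : i != i0 -> D 0 i1 <= D 0 i by rewrite !Dh lecR; exact: hi.
have key := commutator_trace_le rhoE GG' GG D0 i01 Di D01
  (center_adj _ AH) (center_adj _ BH).
have b0p : 0 <= b0%:C by rewrite b0E divr_ge0 ?mulr_ge0 ?ltW.
apply: le_trans (ler_wpM2l b0p key) _.
rewrite mulrA b0E.
(* The constant [b0] is the inverse of 1/lambda1 + 1/lambda2. *)
have -> : D 0 i0 * D 0 i1 / (D 0 i0 + D 0 i1) * ((D 0 i0)^-1 + (D 0 i1)^-1) = 1.
  by field; rewrite !lt0r_neq0.
by rewrite mul1r.
Qed.
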